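(* Consider a finite (oriented) graph or hypergraph with vertex-edge incidence matrix. The nonzero eigenvalues of the vertex $1$-Laplacian and of the edge $\infty$-Laplacian coincide. For $p>1$, with $p^*$ the Hölder conjugate of $p$ ($\frac1p+\frac1{p^*}=1$), let $\Delta_p^V$ and $\Delta_{p^*}^E$ denote the vertex $p$-Laplacian and the edge $p^*$-Laplacian. Then $$\{\lambda^{\frac1p}:\lambda\text{ is a positive eigenvalue of }\Delta_p^V\}=\{\lambda^{\frac1{p^*}}:\lambda\text{ is a positive eigenvalue of }\Delta_{p^*}^E\}.$$
   Context: Let $T$ be the incidence matrix of the (hyper)graph, with rows indexed by edges and columns by vertices (for a graph, the row of an edge has one entry $+1$ and one entry $-1$, at its two endpoints for a chosen orientation, and zeros elsewhere; for an oriented hypergraph the entries are in $\{-1,0,1\}$). For $1<p<\infty$, the eigenvalues of the vertex $p$-Laplacian $\Delta_p^V$ are those of the function pair $(\|T\cdot\|_p^p,\|\cdot\|_p^p)$ on vertex functions, and the eigenvalues of the edge $q$-Laplacian $\Delta_q^E$ ($1<q<\infty$) are those of $(\|T^\top\cdot\|_q^q,\|\cdot\|_q^q)$ on edge functions. The eigenvalues of the vertex $1$-Laplacian are those of $(\|T\cdot\|_1,\|\cdot\|_1)$ and the eigenvalues of the edge $\infty$-Laplacian are those of $(\|T^\top\cdot\|_\infty,\|\cdot\|_\infty)$. Here $\lambda$ is an eigenvalue of a pair $(F,G)$ of convex functions if there is $x\ne0$ with $\nabla F(x)\cap\lambda\nabla G(x)\ne\varnothing$, $\nabla$ being the subdifferential.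 *)

(* Defs.v *)
From HB Require Import structures.
From mathcomp Require Import all_boot all_order all_algebra.
From mathcomp Require Import boolp classical_sets reals topology normedtype exp.

Set Implicit Arguments.
Unset Strict Implicit.
Unset Printing Implicit Defensive.

Import Order.TTheory GRing.Theory Num.Theory.
Import numFieldNormedType.Exports.

Local Open Scope ring_scope.

(* Edges are 'I_m and vertices are 'I_n.  Parallel and empty hyperedges are
   allowed, so that the incidence matrices are exactly the m x n matrices with
   entries in {-1, 0, 1}. *)
Record oriented_hypergraph (m n : nat) := OrientedHypergraph {
  pos_ends : 'I_m -> {set 'I_n};
  neg_ends : 'I_m -> {set 'I_n};
  ends_disjoint : forall e, (pos_ends e :&: neg_ends e = finset.set0)%SET
}.

Record oriented_graph (m n : nat) := OrientedGraph {
  ghead : 'I_m -> 'I_n;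
  gtail : 'I_m -> 'I_n;
  ghead_neq_tail : forall e, ghead e != gtail e
}.

Lemma graph_ends_disjoint (m n : nat) (G : oriented_graph m n) (e : 'I_m) :
  ([set ghead G e] :&: [set gtail G e] = finset.set0)%SET.
Proof.
by apply: disjoint_setI0; rewrite disjoints1 !inE; exact: ghead_neq_tail.
Qed.

Coercion hypergraph_of_graph (m n : nat) (G : oriented_graph m n) :
    oriented_hypergraph m n :=
  OrientedHypergraph (graph_ends_disjoint G).

Definition incidence_mx (R : realType) (m n : nat)
    (H : oriented_hypergraph m n) : 'M[R]_(m, n) :=
  \matrix_(e < m, v < n) ((v \in pos_ends H e)%:R - (v \in neg_ends H e)%:R).

Definition lpnorm (R : realType) (p : R) (n : nat) (x : 'cV[R]_n) : R :=
  (\sum_(i < n) `|x i 0| `^ p) `^ p^-1.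

(* The library norm of a matrix is the maximum of the absolute values of its
   entries (and 0 if there are none). *)
Definition linfnorm (R : realType) (n : nat) (x : 'cV[R]_n) : R := mx_norm x.

Local Open Scope classical_set_scope.

Definition subdifferential (R : realType) (n : nat) (F : 'cV[R]_n -> R)
    (x : 'cV[R]_n) : set 'cV[R]_n :=
  [set u : 'cV[R]_n | forall y : 'cV[R]_n,
     F x + \sum_(i < n) u i 0 * (y i 0 - x i 0) <= F y].

Definition pair_eigenvalue (R : realType) (n : nat) (F G : 'cV[R]_n -> R)
    (l : R) : Prop :=
  exists2 x : 'cV[R]_n, x != 0 &
    subdifferential F x `&` [set l *: w | w in subdifferential G x] !=set0.

Section Laplacians.
Variables (R : realType) (m n : nat) (H : oriented_hypergraph m n).
Let T : 'M[R]_(m, n) := incidence_mx R H.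

Definition vertex_pLaplacian_eigenvalue (p : R) : R -> Prop :=
  pair_eigenvalue (fun x : 'cV[R]_n => lpnorm p (T *m x) `^ p)
                  (fun x : 'cV[R]_n => lpnorm p x `^ p).

Definition edge_pLaplacian_eigenvalue (q : R) : R -> Prop :=
  pair_eigenvalue (fun f : 'cV[R]_m => lpnorm q (T^T *m f) `^ q)
                  (fun f : 'cV[R]_m => lpnorm q f `^ q).

Definition vertex_1Laplacian_eigenvalue : R -> Prop :=
  pair_eigenvalue (fun x : 'cV[R]_n => lpnorm 1 (T *m x))
                  (fun x : 'cV[R]_n => lpnorm 1 x).

Definition edge_inftyLaplacian_eigenvalue : R -> Prop :=
  pair_eigenvalue (fun f : 'cV[R]_m => linfnorm (T^T *m f))
                  (fun f : 'cV[R]_m => linfnorm f).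

End Laplacians.

(* Main.v *)
Require Import Defs.
From mathcomp Require Import all_boot all_order all_algebra.
From mathcomp Require Import boolp classical_sets reals topology normedtype exp.
From mathcomp Require Import derive ring lra.

(** Both halves of the theorem are instances of one fact about a matrix [T]
    between spaces carrying norms [N] and [K], with dual norms [N'] and [K']:
    a positive number is an eigenvalue of the pair (K o T, N) if and only if it
    is an eigenvalue of the transposed pair (N' o T^T, K').

    For a norm, [w] is a subgradient at [x != 0] exactly when [w] has dual norm
    1 and [dot w x = N x]; this condition is symmetric in [x / N x] and [w], so
    [x / N x] is in turn a subgradient of the dual norm at [w].  A subgradient
    of K o T at [x] has the form [T^T *m f] with [f] a subgradient of [K] at
    [T *m x] ([hahn_banach_mulmx]).  If it equals [l *: w] with [w] a subgradient
    of [N] at [x], then reading both relations backwards shows that [f] is an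
    eigenvector of the transposed pair with the same [l]
    ([pair_eigenvalue_transpose]).  The converse is the same statement applied
    to [T^T].

    For the 1-Laplacian and the infinity-Laplacian it only remains to observe
    that the l^1 norm and the maximum norm are dual ([lpnorm1_dual]) and that
    nonzero eigenvalues are positive.  For p > 1, differentiating t |-> F^p(t x)
    at t = 1 and comparing points of equal [F]-value shows that the
    subdifferential of F^p at a point [x] with F(x) > 0 is p F(x)^(p-1) times
    that of [F].  Hence [l > 0] is an eigenvalue of (F^p, G^p) if and only if
    l^(1/p) is an eigenvalue of (F, G) ([pair_eigenvalue_powR]).  So the two sets
    in the statement are the positive eigenvalues of two transposed pairs for the
    dual norms l^p and l^q ([lpnorm_dual]). *)

Set Implicit Arguments.
Unset Strict Implicit.
Unset Printing Implicit Defensive.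

Import Order.TTheory GRing.Theory Num.Theory.
Import numFieldNormedType.Exports.

Local Open Scope classical_set_scope.
Local Open Scope ring_scope.

(** * The Euclidean pairing *)

Definition dot (R : realType) (n : nat) (x y : 'cV[R]_n) : R :=
  (x^T *m y) 0 0.

Section Dot.
Variables (R : realType) (n : nat).
Implicit Types (x y z : 'cV[R]_n) (c : R).

Lemma dotE x y : dot x y = \sum_i x i 0 * y i 0.
Proof. by rewrite /dot mxE; apply: eq_bigr => i _; rewrite mxE. Qed.

Lemma dotC x y : dot x y = dot y x.
Proof. by rewrite !dotE; apply: eq_bigr => i _; rewrite mulrC. Qed.

Lemma dotDr x y z : dot x (y + z) = dot x y + dot x z.
Proof. by rewrite /dot mulmxDr mxE. Qed.

Lemma dotZr c x y : dot x (c *: y) = c * dot x y.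
Proof. by rewrite /dot -scalemxAr mxE. Qed.

Lemma dotZl c x y : dot (c *: x) y = c * dot x y.
Proof. by rewrite dotC dotZr dotC. Qed.

Lemma dotNr x y : dot x (- y) = - dot x y.
Proof. by rewrite -scaleN1r dotZr mulN1r. Qed.

Lemma dotBr x y z : dot x (y - z) = dot x y - dot x z.
Proof. by rewrite dotDr dotNr. Qed.

Lemma dot0r x : dot x 0 = 0.
Proof. by rewrite /dot mulmx0 mxE. Qed.

Lemma dot0l x : dot 0 x = 0.
Proof. by rewrite dotC dot0r. Qed.

Lemma dot_gt0 x : x != 0 -> 0 < dot x x.
Proof.
move=> x0; rewrite dotE lt0r sumr_ge0 ?andbT; last first.
  by move=> i _; rewrite -expr2 sqr_ge0.
apply: contraNneq x0 => /psumr_eq0P x0.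
apply/eqP/colP => i; rewrite mxE; apply/eqP.
by rewrite -sqrf_eq0 expr2 x0// => j _; rewrite -expr2 sqr_ge0.
Qed.

Lemma dot_inj x y : (forall z, dot x z = dot y z) -> x = y.
Proof.
move=> xy; apply/eqP; rewrite -subr_eq0; apply/negPn/negP => /dot_gt0.
by rewrite dotBr dotC [dot _ y]dotC !dotBr !xy !(dotC y) subrr ltxx.
Qed.

End Dot.

Lemma dot_trmx (R : realType) (m n : nat) (T : 'M[R]_(m, n)) f x :
  dot (T^T *m f) x = dot f (T *m x).
Proof. by rewrite /dot trmx_mul trmxK mulmxA. Qed.

Lemma dot_col_mx (R : realType) (n k : nat) (u y : 'cV[R]_n) (v z : 'cV_k) :
  dot (col_mx u v) (col_mx y z) = dot u y + dot v z.
Proof. by rewrite /dot tr_col_mx mul_row_col mxE. Qed.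

(** * Gauges and their subgradients *)

Section Gauges.
Variables (R : realType) (n : nat).
Implicit Types (F : 'cV[R]_n -> R) (x y u : 'cV[R]_n).

(** A seminorm without subadditivity and symmetry: positive homogeneity alone
    already determines the shape of subgradients. *)
Definition gauge F :=
  (forall x, 0 <= F x) /\ (forall c x, 0 <= c -> F (c *: x) = c * F x).

Definition subadditive F := forall x y, F (x + y) <= F x + F y.

Lemma gauge0 F : gauge F -> F 0 = 0.
Proof. by move=> [_ hF]; rewrite -(scale0r 0) hF// mul0r. Qed.

Lemma subdifferentialE F x u :
  subdifferential F x u <-> forall y, F x + (dot u y - dot u x) <= F y.
Proof.
by split=> h y; have := h y; under eq_bigr do rewrite mulrBr;
  rewrite sumrB -!dotE.
Qed.

(** Comparing with the points 0 and 2 x in the subgradient inequality pins down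
    [dot u x]. *)
Lemma subdifferential_gauge F x u : gauge F ->
  subdifferential F x u <-> (forall y, dot u y <= F y) /\ dot u x = F x.
Proof.
move=> gF; have [F0 hF] := gF; rewrite subdifferentialE; split => [h|[h e] y].
  have ux : dot u x = F x.
    have := h 0; have := h (2 *: x); rewrite dot0r gauge0// dotZr hF//; lra.
  by split => // y; have := h y; rewrite ux; lra.
by rewrite e; have := h y; lra.
Qed.

End Gauges.

(** * A finite-dimensional Hahn-Banach theorem *)

Section HahnBanach.
Variables (R : realType) (m : nat) (N : 'cV[R]_m -> R).
Hypotheses (gN : gauge N) (subN : subadditive N).

(** The one-dimensional extension step: the value [c] at the new direction [z]
    has to lie between the numbers [dot u y - N (T *m y - z)] and
    [N (T *m y + z) - dot u y], and subadditivity makes the former at most the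
    latter.  A linear functional on the range of [T] is written through its
    pullback [u] to the domain of [T]; the domination hypothesis forces it to be
    well defined. *)
Lemma hahn_banach_column (n : nat) (T : 'M[R]_(m, n)) (u : 'cV_n) (z : 'cV_m) :
  (forall y, dot u y <= N (T *m y)) ->
  exists c, forall y (t : R), dot u y + c * t <= N (T *m y + t *: z).
Proof.
move=> dom; have [_ hN] := gN.
pose A := range (fun y => dot u y - N (T *m y - z)).
have Aub y' : ubound A (N (T *m y' + z) - dot u y').
  move=> _ [y _ <-]; have := dom (y + y'); rewrite dotDr mulmxDr.
  have := subN (T *m y - z) (T *m y' + z); rewrite addrACA addNr addr0; lra.
have A0 : A !=set0 by exists (dot u 0 - N (T *m 0 - z)), 0.
pose c := sup A; exists c => y t.
have c_ge y' : dot u y' - N (T *m y' - z) <= c.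
  by apply: ub_le_sup; [exists (N (T *m 0 + z) - dot u 0); exact: Aub|exists y'].
have c_le y' : c <= N (T *m y' + z) - dot u y' by apply: ge_sup.
(* By homogeneity only t = 1 and t = -1 matter. *)
have [t0|t0|->] := ltgtP t 0; last first.
- by rewrite mulr0 scale0r !addr0.
- have := c_le (t^-1 *: y); rewrite -(ler_pM2l t0) mulrBr -(hN _ _ (ltW t0)).
  rewrite scalerDr -scalemxAr !scalerA dotZr mulrA divff ?gt_eqF//.
  by rewrite mul1r scale1r; lra.
- have s0 : 0 < - t by rewrite oppr_gt0.
  have := c_ge ((- t)^-1 *: y); rewrite -(ler_pM2l s0) mulrBr -(hN _ _ (ltW s0)).
  rewrite scalerDr -scalemxAr !scalerA dotZr mulrA divff ?gt_eqF//.
  by rewrite mul1r scale1r scalerN scaleNr opprK; lra.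
Qed.

Lemma hahn_banach_columns (k n : nat) (T : 'M[R]_(m, n)) (u : 'cV_n)
    (B : 'M[R]_(m, k)) :
  (forall y, dot u y <= N (T *m y)) ->
  exists c : 'cV_k, forall y s, dot u y + dot c s <= N (T *m y + B *m s).
Proof.
elim: k n T u B => [|k IH] n T u B dom.
  by exists 0 => y s; rewrite (flatmx0 s) dot0r mulmx0 !addr0.
rewrite -[k.+1]/(1 + k)%N in B *.
have [c1 dom1] := hahn_banach_column (lsubmx B) dom.
have dom2 y : dot (col_mx u c1%:M) y <= N (row_mx T (lsubmx B) *m y).
  rewrite -[y]vsubmxK dot_col_mx mul_row_col.
  rewrite [dsubmx y]mx11_scalar mul_mx_scalar.
  have -> d : dot c1%:M d%:M = c1 * d.
    by rewrite dotE big_ord1 !mxE eqxx !mulr1n.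
  exact: dom1.
have [c2 dom3] := IH _ _ _ (rsubmx B) dom2.
exists (col_mx c1%:M c2) => y s.
have := dom3 (col_mx y (usubmx s)) (dsubmx s).
rewrite -[in X in _ -> X](hsubmxK B) -[in X in _ -> X](vsubmxK s).
by rewrite !dot_col_mx !mul_row_col !addrA.
Qed.

(** Extending to the columns of the identity matrix gives a functional on the
    whole codomain.  Evaluating the domination at [T *m y + s = 0] forces it to
    restrict to [u] on the range of [T]. *)
Lemma hahn_banach_mulmx (n : nat) (T : 'M[R]_(m, n)) (u : 'cV_n) :
  (forall y, dot u y <= N (T *m y)) ->
  exists2 f : 'cV_m, T^T *m f = u & forall z, dot f z <= N z.
Proof.
move=> /(hahn_banach_columns 1%:M)[f dom].
have domf z : dot f z <= N z.
  by have := dom 0 z; rewrite dot0r mulmx0 !add0r mul1mx.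
exists f => //; apply: dot_inj => y; rewrite dot_trmx.
have N0 := gauge0 gN.
have := dom y (- (T *m y)); have := dom (- y) (T *m y).
rewrite !mul1mx mulmxN addNr subrr N0 !dotNr; lra.
Qed.

End HahnBanach.

(** * Dual gauges and the transposition of eigenvalues *)

Section DualGauges.
Variables (R : realType).

(** Each function is the support function of the unit ball of the other, with
    the suprema attained.  Homogeneity, subadditivity and definiteness follow, so
    that Minkowski's inequality never has to be proved. *)
Record dual_gauges (n : nat) (N M : 'cV[R]_n -> R) : Prop := DualGauges {
  dual_ge0l : forall x, 0 <= N x;
  dual_ge0r : forall y, 0 <= M y;
  dual_holder : forall x y, dot x y <= N x * M y;
  dual_norming_left : forall x, exists2 y, M y <= 1 & dot x y = N x;
  dual_norming_right : forall y, exists2 x, N x <= 1 & dot x y = M y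
}.

Lemma dual_gauges_sym n (N M : 'cV[R]_n -> R) :
  dual_gauges N M -> dual_gauges M N.
Proof.
move=> [N0 M0 h nl nr]; split=> // [x y|y|x].
- by rewrite dotC mulrC.
- by have [x ? ?] := nr y; exists x; rewrite // dotC.
- by have [y ? ?] := nl x; exists y; rewrite // dotC.
Qed.

Section Theory.
Variables (n : nat) (N M : 'cV[R]_n -> R).
Hypothesis NM : dual_gauges N M.
Let N0 := dual_ge0l NM.

Lemma dual_le x y : M y <= 1 -> dot x y <= N x.
Proof.
move=> y1; apply: le_trans (dual_holder NM x y) _.
by rewrite -[leRHS]mulr1 ler_wpM2l.
Qed.

Lemma dual_gauge : gauge N.
Proof.
split=> // c x; rewrite le_eqVlt => /predU1P[<-|c0].
  by have [y _ <-] := dual_norming_left NM (0 *: x); rewrite scale0r dot0l mul0r.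
apply/eqP; rewrite eq_le; apply/andP; split.
  have [y y1 <-] := dual_norming_left NM (c *: x).
  by rewrite dotZl ler_pM2l// dual_le.
have [y y1 <-] := dual_norming_left NM x.
by rewrite -dotZl dual_le.
Qed.

Lemma dual_subadditive : subadditive N.
Proof.
move=> x x'; have [y y1 <-] := dual_norming_left NM (x + x').
by rewrite dotC dotDr !(dotC y) lerD// dual_le.
Qed.

Lemma dual_gt0 x : x != 0 -> 0 < N x.
Proof.
move=> /dot_gt0 x0; rewrite lt0r N0 andbT; apply: contraTneq x0 => Nx0.
by rewrite -leNgt (le_trans (dual_holder NM x x))// Nx0 mul0r.
Qed.

Lemma dual_le1 w : (forall y, dot w y <= N y) -> M w <= 1.
Proof.
move=> h; have [x x1 <-] := dual_norming_right NM w.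
by rewrite dotC (le_trans (h x)).
Qed.

(** The bound from below is Hoelder's inequality at [x] itself. *)
Lemma dual_eq1 x w : x != 0 -> (forall y, dot w y <= N y) -> dot w x = N x ->
  M w = 1.
Proof.
move=> /dual_gt0 x0 h e; apply/eqP; rewrite eq_le dual_le1//=.
by have := dual_holder NM x w; rewrite dotC e ler_pMr.
Qed.

End Theory.

Lemma gauge_mulmx m n (T : 'M[R]_(m, n)) (K : 'cV[R]_m -> R) :
  gauge K -> gauge (fun x => K (T *m x)).
Proof. by move=> [K0 hK]; split=> // c x c0; rewrite -scalemxAr hK. Qed.

(** The new eigenvector is the Hahn-Banach extension [f] of the common
    subgradient.  Both new subgradients are multiples of [T *m x]: scaled by
    [1 / N x] it is one for the transposed seminorm, scaled by [1 / K (T *m x)]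
    it is one for [K'], and the ratio of these scalars is [l]. *)
Lemma pair_eigenvalue_transpose m n (T : 'M[R]_(m, n))
    (N N' : 'cV[R]_n -> R) (K K' : 'cV[R]_m -> R) (l : R) :
  dual_gauges N N' -> dual_gauges K K' -> 0 < l ->
  pair_eigenvalue (fun x => K (T *m x)) N l ->
  pair_eigenvalue (fun f => N' (T^T *m f)) K' l.
Proof.
have gKT := gauge_mulmx T (dual_gauge _); move=> NN KK l0 [x x0 [u []]].
move=> /(subdifferential_gauge _ _ (gKT _ _ KK))[domu ux] [w].
move=> /(subdifferential_gauge _ _ (dual_gauge NN))[domw wx] uw.
have Nx := dual_gt0 NN x0.
have [gN' gK'] := (dual_gauge (dual_gauges_sym NN),
  dual_gauge (dual_gauges_sym KK)).
have N'w : N' w = 1 by exact: (dual_eq1 NN x0).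
have [f Tf domf] := hahn_banach_mulmx (dual_gauge KK) (dual_subadditive KK) domu.
have KTx : K (T *m x) = l * N x by rewrite -ux -uw dotZl wx.
have Tx0 : T *m x != 0.
  apply: contraPneq KTx => ->; rewrite (gauge0 (dual_gauge KK)) => /esym/eqP.
  by rewrite gt_eqF// mulr_gt0.
have fTx : dot f (T *m x) = K (T *m x) by rewrite -dot_trmx Tf ux.
have K'f : K' f = 1 by exact: (dual_eq1 KK Tx0).
exists f.
  by apply: contra_eq_neq K'f => ->; rewrite (gauge0 gK') eq_sym oner_neq0.
exists ((N x)^-1 *: (T *m x)); split.
  apply/subdifferential_gauge; first exact: gauge_mulmx.
  split=> [h|].
    rewrite dotZl dotC -dot_trmx dotC ler_pdivrMl//.
    by rewrite (dual_holder NN).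
  rewrite dotZl dotC fTx KTx Tf -uw (proj2 gN') ?ltW// N'w.
  by rewrite mulr1 mulrCA mulVf ?mulr1 ?gt_eqF.
exists ((K (T *m x))^-1 *: (T *m x)); last first.
  by rewrite scalerA KTx invfM mulrA divff ?mul1r// gt_eqF.
apply/subdifferential_gauge => //.
have KTx0 := dual_gt0 KK Tx0.
split=> [h|].
  by rewrite dotZl ler_pdivrMl// (dual_holder KK).
by rewrite dotZl dotC fTx K'f mulVf ?gt_eqF.
Qed.

Lemma pair_eigenvalue_transposeE m n (T : 'M[R]_(m, n))
    (N N' : 'cV[R]_n -> R) (K K' : 'cV[R]_m -> R) (l : R) :
  dual_gauges N N' -> dual_gauges K K' -> 0 < l ->
  pair_eigenvalue (fun x => K (T *m x)) N l <->
  pair_eigenvalue (fun f => N' (T^T *m f)) K' l.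
Proof.
move=> NN KK l0; split; first exact: pair_eigenvalue_transpose.
have := @pair_eigenvalue_transpose _ _ T^T _ _ _ _ l
  (dual_gauges_sym KK) (dual_gauges_sym NN) l0.
by rewrite trmxK.
Qed.

End DualGauges.

(** * Powers of gauges *)

Section Powers.
Variable R : realType.

(** The graph of t^p lies above its tangent at [a]; this is Young's inequality
    for [b] and a^(p-1), whose conjugate exponent is p / (p - 1). *)
Lemma powR_tangent (p a b : R) : 1 < p -> 0 <= a -> 0 <= b ->
  a `^ p + p * a `^ (p - 1) * (b - a) <= b `^ p.
Proof.
move=> p1 a0 b0; have p0 : 0 < p by lra.
have pn0 : p != 0 by rewrite gt_eqF.
have q0 : 0 < p / (p - 1) by rewrite divr_gt0// subr_gt0.
have aa : a `^ (p - 1) * a = a `^ p.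
  by rewrite -{2}[a]powRr1// -powRD subrK// (negPf pn0).
have := conjugate_powR b0 (powR_ge0 a (p - 1)) p0 q0.
have pm1 : p - 1 != 0 by rewrite gt_eqF// subr_gt0.
rewrite -powRrM mulrCA divff// mulr1.
have -> : p^-1 + (p / (p - 1))^-1 = 1 by field; rewrite pn0 pm1.
move=> /(_ erefl); rewrite -(ler_pM2l p0) mulrDr.
have -> : p * (b `^ p / p) = b `^ p by field; rewrite pn0.
have -> : p * (a `^ p / (p / (p - 1))) = (p - 1) * a `^ p.
  by field; rewrite pn0 pm1.
rewrite mulrBr -[p * _ * a]mulrA aa.
move: (a `^ p) (b `^ p) (a `^ (p - 1)) => A B C; lra.
Qed.

(** The difference of the two sides is minimal at t = 1, where its derivative
    [c * p - d] must vanish. *)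
Lemma powR_slope (p c d : R) :
  (forall t : R, 0 < t -> (t - 1) * d <= (t `^ p - 1) * c) -> d = p * c.
Proof.
move=> h; pose f (t : R) : R := c * t `^ p - d * t.
have df (t : R) : 0 < t -> is_derive t 1 f (c * (p * t `^ (p - 1)) - d * 1).
  move=> t0; have pt := is_derive1_powR p t0.
  exact: (is_deriveB (is_deriveZ c pt) (is_deriveZ d (is_derive_id t 1))).
have f1 : is_derive (1 : R) 1 f 0.
  apply: (@derive1_at_min _ f 0 2).
  - by [].
  - by move=> t; rewrite in_itv/= => /andP[t0 _]; have [] := df t t0.
  - by rewrite in_itv/=; apply/andP; split; lra.
  - move=> t; rewrite in_itv/= => /andP[t0 _]; have := h t t0.
    by rewrite /f powR1; lra.
have [_ e1] := df 1 ltr01; have [_ e2] := f1.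
by move: e1; rewrite e2 powR1; lra.
Qed.

Variable n : nat.
Implicit Types (F G : 'cV[R]_n -> R) (x y u w : 'cV[R]_n).

(** Euler's relation, obtained from the subgradient inequality along the ray
    through [x].  It also covers [F x = 0]. *)
Lemma subdifferential_powR_dot F (p : R) x u : gauge F ->
  subdifferential (fun y => F y `^ p) x u -> dot u x = p * F x `^ p.
Proof.
move=> [F0 hF] /subdifferentialE h; apply: powR_slope => t t0.
have := h (t *: x).
rewrite (hF _ _ (ltW t0)) (powRM _ (ltW t0) (F0 x)) dotZr; lra.
Qed.

(** From left to right, rescale the test point [y] so that [F y = F x]: the
    p-th powers then cancel.  When [F y = 0] no rescaling achieves this, but
    letting [y] grow makes a positive [dot u y] contradict the inequality. *)
Lemma subdifferential_powR F (p : R) x u : 1 < p -> gauge F -> 0 < F x ->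
  subdifferential (fun y => F y `^ p) x ((p * F x `^ (p - 1)) *: u) <->
  subdifferential F x u.
Proof.
move=> p1 gF Fx; have [F0 hF] := gF.
set k := p * F x `^ (p - 1); have k0 : 0 < k.
  by rewrite mulr_gt0 ?powR_gt0// (lt_trans _ p1).
have kF : k * F x = p * F x `^ p.
  rewrite -mulrA -{2}[F x]powRr1// -powRD subrK//.
  by rewrite (gt_eqF Fx) implybT.
rewrite (subdifferential_gauge _ _ gF); split=> [h|[domu ux]]; last first.
  apply/subdifferentialE => y; apply: le_trans (powR_tangent p1 (F0 x) (F0 y)).
  rewrite -/k !dotZl ux lerD2l -mulrBr ler_pM2l// lerB//.
have := subdifferential_powR_dot gF h; rewrite dotZl -kF => /(mulfI _) ux.
have {}ux : dot u x = F x by apply: ux; rewrite gt_eqF.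
split => // y; move/subdifferentialE: h => h.
have [Fy|] := eqVneq (F y) 0.
  rewrite Fy leNgt; apply/negP => uy.
  (* The multiple of y on which u takes the value F x + dot u y. *)
  have s0 : 0 <= F x / dot u y + 1 by rewrite addr_ge0// divr_ge0// ltW.
  have := h ((F x / dot u y + 1) *: y).
  rewrite (hF _ _ s0) Fy mulr0 powR0 ?(gt_eqF (lt_trans ltr01 p1))//.
  rewrite dotZr !dotZl ux mulrCA mulrDl divfK ?(gt_eqF uy)// mul1r -mulrBr.
  rewrite addrAC subrr add0r leNgt => /negP; apply.
  by apply: ltr_wpDl; [exact: powR_ge0|exact: mulr_gt0].
rewrite neq_lt ltNge F0/= => Fy; have := h ((F x / F y) *: y).
rewrite (hF _ _ (divr_ge0 (F0 _) (F0 _))) divfK ?gt_eqF// gerDl subr_le0.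
rewrite dotZl [leRHS]dotZl ler_pM2l// dotZr ux mulrAC ler_pdivrMr//.
by rewrite ler_pM2l.
Qed.

(** Pairing both subgradients with [x] gives [F x ^ p = l * G x ^ p], that is
    [F x = mu * G x] with [mu] the p-th root of [l].  The factors relating the
    subgradients of the powers to those of the gauges then differ exactly by
    [l / mu]. *)
Lemma pair_eigenvalue_powR F G (p l : R) :
  1 < p -> gauge F -> gauge G -> (forall x, x != 0 -> 0 < G x) -> 0 < l ->
  pair_eigenvalue (fun x => F x `^ p) (fun x => G x `^ p) l <->
  pair_eigenvalue F G (l `^ p^-1).
Proof.
move=> p1 gF gG Gpos l0; have p0 : 0 < p := lt_trans ltr01 p1.
have [F0 _] := gF; have [G0 _] := gG.
set mu := l `^ p^-1; have mu0 : 0 < mu by rewrite powR_gt0.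
have muE : mu `^ p = l by rewrite -powRrM mulVf ?gt_eqF// powRr1// ltW.
have coefE a : 0 < a -> p * (mu * a) `^ (p - 1) * mu = l * (p * a `^ (p - 1)).
  move=> a0; rewrite powRM ?(ltW mu0) ?(ltW a0)//.
  have -> : l = mu `^ (p - 1) * mu.
    rewrite -muE -{3}[mu]powRr1 ?(ltW mu0)// -powRD subrK//.
    by rewrite (gt_eqF mu0) implybT.
  ring.
have coef0 a : 0 < a -> 0 < p * a `^ (p - 1) by move=> ?; rewrite mulr_gt0 ?powR_gt0.
split=> -[x x0 [u [uF [w wG wu]]]]; exists x => //; have Gx := Gpos x x0.
- have uxF := subdifferential_powR_dot gF uF.
  have wxG := subdifferential_powR_dot gG wG.
  have FGp : F x `^ p = (mu * G x) `^ p.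
    move: uxF; rewrite -wu dotZl wxG powRM ?(ltW mu0)// muE mulrCA.
    by move/(mulfI (lt0r_neq0 p0)).
  have FG : F x = mu * G x.
    by apply: (powR_injective p0) FGp; rewrite nnegrE ?mulr_ge0 ?(ltW mu0).
  have Fx : 0 < F x by rewrite FG mulr_gt0.
  have [kF kG] := (coef0 _ Fx, coef0 _ Gx).
  exists ((p * F x `^ (p - 1))^-1 *: u); split.
    apply/(subdifferential_powR _ p1 gF Fx).
    by rewrite scalerA divff ?scale1r ?gt_eqF.
  exists ((p * G x `^ (p - 1))^-1 *: w).
    apply/(subdifferential_powR _ p1 gG Gx).
    by rewrite scalerA divff ?scale1r ?gt_eqF.
  rewrite -wu !scalerA; congr (_ *: _).
  apply: (mulfI (lt0r_neq0 kF)); rewrite [RHS]mulrA divff ?gt_eqF// mul1r.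
  by rewrite mulrA FG coefE// mulfK ?gt_eqF.
- have [_ ux] := (subdifferential_gauge _ _ gF).1 uF.
  have [_ wx] := (subdifferential_gauge _ _ gG).1 wG.
  have FG : F x = mu * G x by rewrite -ux -wu dotZl wx.
  have Fx : 0 < F x by rewrite FG mulr_gt0.
  exists ((p * F x `^ (p - 1)) *: u); split.
    exact/(subdifferential_powR _ p1 gF Fx).
  exists ((p * G x `^ (p - 1)) *: w).
    exact/(subdifferential_powR _ p1 gG Gx).
  by rewrite -wu !scalerA FG coefE.
Qed.

End Powers.

(** * Duality of the classical norms *)

Section LpNorms.
Variables (R : realType) (n : nat).
Implicit Types (x y : 'cV[R]_n) (p q : R).

Lemma lpnorm_ge0 p x : 0 <= lpnorm p x.
Proof. exact: powR_ge0. Qed.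

Lemma lpnorm0 p : p != 0 -> lpnorm p (0 : 'cV[R]_n) = 0.
Proof.
move=> p0; rewrite /lpnorm big1 ?powR0 ?invr_eq0// => i _.
by rewrite mxE normr0 powR0.
Qed.

Lemma lpnorm_eq0 p x : lpnorm p x = 0 -> x = 0.
Proof.
move=> /powR_eq0_eq0/psumr_eq0P x0; apply/colP => i; rewrite mxE.
by apply/normr0_eq0/(@powR_eq0_eq0 _ _ p)/x0 => // j _; exact: powR_ge0.
Qed.

Lemma lpnorm_powR p x : p != 0 -> lpnorm p x `^ p = \sum_i `|x i 0| `^ p.
Proof.
move=> p0; rewrite /lpnorm -powRrM mulVf// powRr1//.
by apply: sumr_ge0 => i _; exact: powR_ge0.
Qed.

Lemma sum_normalized_powR p x : p != 0 -> 0 < lpnorm p x ->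
  \sum_i (`|x i 0| / lpnorm p x) `^ p = 1.
Proof.
move=> p0 Nx; have Vx : 0 <= (lpnorm p x)^-1 by rewrite invr_ge0 ltW.
under eq_bigr do rewrite powRM//.
rewrite -mulr_suml -lpnorm_powR// -powRM ?(ltW Nx)//.
by rewrite divff ?gt_eqF// powR1.
Qed.

(** Young's inequality, summed. *)
Lemma sum_mul_le1 p q (a b : 'I_n -> R) :
  0 < p -> 0 < q -> p^-1 + q^-1 = 1 ->
  (forall i, 0 <= a i) -> (forall i, 0 <= b i) ->
  \sum_i a i `^ p = 1 -> \sum_i b i `^ q = 1 -> \sum_i a i * b i <= 1.
Proof.
move=> p0 q0 pq a0 b0 Sa Sb.
apply: (@le_trans _ _ (\sum_i (a i `^ p / p + b i `^ q / q))).
  by apply: ler_sum => i _; exact: conjugate_powR (a0 i) (b0 i) p0 q0 pq.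
by rewrite big_split/= -!mulr_suml Sa Sb !mul1r pq.
Qed.

Lemma lpnorm_holder p q x y : 0 < p -> 0 < q -> p^-1 + q^-1 = 1 ->
  dot x y <= lpnorm p x * lpnorm q y.
Proof.
move=> p0 q0 pq; have [pn0 qn0] := (lt0r_neq0 p0, lt0r_neq0 q0).
have := lpnorm_ge0 p x; rewrite le_eqVlt => /predU1P[/esym Nx|Nx].
  by rewrite Nx mul0r (lpnorm_eq0 Nx) dot0l.
have := lpnorm_ge0 q y; rewrite le_eqVlt => /predU1P[/esym Ny|Ny].
  by rewrite Ny mulr0 (lpnorm_eq0 Ny) dot0r.
have Sx := sum_normalized_powR pn0 Nx.
have Sy := sum_normalized_powR qn0 Ny.
(* Only the normalisation of the two vectors matters from here on. *)
move: (lpnorm p x) (lpnorm q y) Nx Ny Sx Sy => c d c0 d0 Sx Sy.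
have := sum_mul_le1 p0 q0 pq (fun i => divr_ge0 (normr_ge0 (x i 0)) (ltW c0))
  (fun i => divr_ge0 (normr_ge0 (y i 0)) (ltW d0)) Sx Sy.
rewrite -(ler_pM2l (mulr_gt0 c0 d0)) mulr1; apply: le_trans.
rewrite dotE mulr_sumr; apply: ler_sum => i _.
have -> : c * d * (`|x i 0| / c * (`|y i 0| / d)) = `|x i 0 * y i 0|.
  by rewrite normrM; field; rewrite !gt_eqF.
exact: ler_norm.
Qed.

(** The functional attaining the norm has entries sg(x_i) (|x_i| / N)^(p-1)
    with [N] the norm of [x]; its q-th powers are those of the normalised [x]
    since (p - 1) q = p. *)
Lemma lpnorm_norming p q x : 1 < p -> p^-1 + q^-1 = 1 ->
  exists2 y, lpnorm q y <= 1 & dot x y = lpnorm p x.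
Proof.
move=> p1 pq; have p0 : 0 < p := lt_trans ltr01 p1.
have pn0 := lt0r_neq0 p0.
have qE : q = p / (p - 1).
  rewrite -[LHS]invrK (_ : q^-1 = 1 - p^-1); last by rewrite -pq addrC addKr.
  have pm : p - 1 != 0 by rewrite subr_eq0 gt_eqF.
  by field; rewrite pm.
have qn0 : q != 0 by rewrite qE mulf_neq0 ?invr_eq0 ?subr_eq0 ?gt_eqF.
have := lpnorm_ge0 p x; rewrite le_eqVlt => /predU1P[/esym Nx|Nx].
  by exists 0; rewrite ?lpnorm0// dot0r Nx.
have p10 : p - 1 != 0 by rewrite subr_eq0 gt_eqF.
pose a i := `|x i 0| / lpnorm p x.
have a0 i : 0 <= a i by rewrite divr_ge0// ltW.
exists (\col_i (Num.sg (x i 0) * a i `^ (p - 1))).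
  suff -> : lpnorm q (\col_i (Num.sg (x i 0) * a i `^ (p - 1))) = 1 by [].
  rewrite /lpnorm (eq_bigr (fun i => a i `^ p)); last first.
    move=> i _; rewrite mxE normrM (ger0_norm (powR_ge0 _ _)) normr_sg.
    have [x0|x0] := eqVneq (x i 0) 0; last first.
      by rewrite mul1r -powRrM qE mulrCA divff// mulr1.
    by rewrite mul0r /a x0 normr0 mul0r !powR0.
  by rewrite sum_normalized_powR// powR1.
rewrite dotE (eq_bigr (fun i => lpnorm p x * a i `^ p)); last first.
  move=> i _; rewrite mxE mulrA [x i 0 * _]mulrC -normrEsg.
  have -> : `|x i 0| = lpnorm p x * a i by rewrite /a mulrC divfK ?gt_eqF.
  rewrite -mulrA; congr (_ * _).
  by rewrite -{1}[a i]powRr1// -powRD [1 + _]addrC subrK// (negPf pn0).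
by rewrite -mulr_sumr sum_normalized_powR// mulr1.
Qed.

Lemma conjugate_exponent_gt1 p q : 1 < p -> p^-1 + q^-1 = 1 -> 1 < q.
Proof.
move=> p1 pq; have p0 : 0 < p := lt_trans ltr01 p1.
have q0 : 0 < q by rewrite -invr_gt0 -(ltrD2l p^-1) pq addr0 invf_lt1.
by rewrite -invf_lt1// -pq ltrDr invr_gt0.
Qed.

Lemma lpnorm_dual p q : 1 < p -> p^-1 + q^-1 = 1 ->
  dual_gauges (@lpnorm R p n) (@lpnorm R q n).
Proof.
move=> p1 pq; have p0 : 0 < p := lt_trans ltr01 p1.
have q1 := conjugate_exponent_gt1 p1 pq; have q0 : 0 < q := lt_trans ltr01 q1.
split; [exact: lpnorm_ge0|exact: lpnorm_ge0| | |].
- by move=> x y; exact: lpnorm_holder.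
- by move=> x; exact: lpnorm_norming.
- move=> y; rewrite addrC in pq; have [x] := lpnorm_norming y q1 pq.
  by exists x => //; rewrite dotC.
Qed.

Lemma lpnorm1E x : lpnorm 1 x = \sum_i `|x i 0|.
Proof.
rewrite /lpnorm invr1 powRr1; last by apply: sumr_ge0 => i _; exact: powR_ge0.
by apply: eq_bigr => i _; rewrite powRr1.
Qed.

Lemma linfnorm_ge0 x : 0 <= linfnorm x.
Proof. by rewrite /linfnorm mx_normrE bigmax_ge_id. Qed.

Lemma le_linfnorm x i : `|x i 0| <= linfnorm x.
Proof.
rewrite /linfnorm mx_normrE.
exact: (le_bigmax _ (fun ij => `|x ij.1 ij.2|) (i, 0)).
Qed.

(** The sign vector of [x] attains its l^1 norm, and a signed unit vector at a
    largest entry attains the maximum norm. *)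
Lemma lpnorm1_dual : dual_gauges (@lpnorm R 1 n) (@linfnorm R n).
Proof.
split; [exact: lpnorm_ge0|exact: linfnorm_ge0| | |].
- move=> x y; rewrite lpnorm1E dotE mulr_suml; apply: ler_sum => i _.
  by rewrite (le_trans (ler_norm _))// normrM ler_wpM2l// le_linfnorm.
- move=> x; exists (\col_i Num.sg (x i 0)).
    rewrite /linfnorm mx_normrE; apply/bigmax_leP; split=> // -[i j] _ /=.
    by rewrite mxE normr_sg; case: (_ != _).
  rewrite lpnorm1E dotE; apply: eq_bigr => i _.
  by rewrite mxE mulrC -normrEsg.
- move=> y; have [y0|/mx_norm_neq0[[i j]/= yi]] := eqVneq (linfnorm y) 0.
    exists 0; first by rewrite lpnorm0 ?oner_neq0.
    by rewrite dot0l y0.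
  exists (Num.sg (y i 0) *: delta_mx i 0).
    rewrite lpnorm1E (bigD1 i)//= big1 => [|k ki].
      by rewrite !mxE !eqxx mulr1 addr0 normr_sg; case: (_ != _).
    by rewrite !mxE (negPf ki) mulr0 normr0.
  rewrite dotZl /dot trmx_delta -rowE mxE /linfnorm yi (ord1 j).
  by rewrite [RHS]normrEsg.
Qed.

End LpNorms.

(** * Eigenvalues of the Laplacians *)

Lemma pair_eigenvalue_gt0 (R : realType) (n : nat) (F G : 'cV[R]_n -> R) l :
  gauge F -> gauge G -> (forall x, x != 0 -> 0 < G x) -> l != 0 ->
  pair_eigenvalue F G l -> 0 < l.
Proof.
move=> gF gG Gpos l0 [x x0 [u [/(subdifferential_gauge _ _ gF)[_ ux]]]].
move=> [w /(subdifferential_gauge _ _ gG)[_ wx] uw].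
rewrite lt0r l0 -(pmulr_lge0 _ (Gpos x x0)) -wx -dotZl uw ux/=.
exact: (proj1 gF).
Qed.

Lemma image_root_eigenvalues (R : realType) (n : nat) (F G : 'cV[R]_n -> R)
    (p : R) :
  1 < p -> gauge F -> gauge G -> (forall x, x != 0 -> 0 < G x) ->
  [set l `^ p^-1 | l in [set l : R | 0 < l /\
     pair_eigenvalue (fun x => F x `^ p) (fun x => G x `^ p) l]] =
  [set mu : R | 0 < mu /\ pair_eigenvalue F G mu].
Proof.
move=> p1 gF gG Gpos; have p0 : 0 < p := lt_trans ltr01 p1.
apply/seteqP; split=> [_ [l [l0 el] <-]|mu [mu0 emu]].
  by split; [exact: powR_gt0|apply/(pair_eigenvalue_powR p1 gF gG Gpos l0)].
have muE : (mu `^ p) `^ p^-1 = mu.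
  by rewrite -powRrM divff ?gt_eqF// powRr1// ltW.
exists (mu `^ p) => //; have mup : 0 < mu `^ p by exact: powR_gt0.
by split=> //; apply/(pair_eigenvalue_powR p1 gF gG Gpos mup); rewrite muE.
Qed.

Theorem proposition2p8 (R : realType) (m n : nat)
    (H : oriented_hypergraph m n) :
  [set l : R | l != 0 /\ vertex_1Laplacian_eigenvalue H l] =
    [set l : R | l != 0 /\ edge_inftyLaplacian_eigenvalue H l] /\
  (forall p q : R, 1 < p -> p^-1 + q^-1 = 1 ->
    [set l `^ p^-1 | l in
      [set l : R | 0 < l /\ vertex_pLaplacian_eigenvalue H p l]] =
    [set l `^ q^-1 | l in
      [set l : R | 0 < l /\ edge_pLaplacian_eigenvalue H q l]]).
Proof.
split=> [|p q p1 pq].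
  have [D1 D2] := (lpnorm1_dual R n, lpnorm1_dual R m).
  have [S1 S2] := (dual_gauges_sym D1, dual_gauges_sym D2).
  apply/seteqP; split=> l [l0 el]; split=> //.
    apply/(pair_eigenvalue_transposeE _ D1 D2) => //.
    apply: pair_eigenvalue_gt0 el => //; last exact: dual_gt0 D1.
      exact/gauge_mulmx/(dual_gauge D2).
    exact: dual_gauge D1.
  apply/(pair_eigenvalue_transposeE _ D1 D2) => //.
  apply: pair_eigenvalue_gt0 el => //; last exact: dual_gt0 S2.
    exact/gauge_mulmx/(dual_gauge S1).
  exact: dual_gauge S2.
have [D1 D2] := (lpnorm_dual n p1 pq, lpnorm_dual m p1 pq).
have [S1 S2] := (dual_gauges_sym D1, dual_gauges_sym D2).
have q1 := conjugate_exponent_gt1 p1 pq.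
rewrite (image_root_eigenvalues p1 (gauge_mulmx _ (dual_gauge D2))
  (dual_gauge D1) (dual_gt0 D1)).
rewrite (image_root_eigenvalues q1 (gauge_mulmx _ (dual_gauge S1))
  (dual_gauge S2) (dual_gt0 S2)).
by apply/seteqP; split=> l [l0 el]; split=> //;
  apply/(pair_eigenvalue_transposeE _ D1 D2).
Qed.
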